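(* Let $\mathcal{A}=(Q,\Sigma,\delta)$ be a synchronizing deterministic finite automaton with $n=|Q|$ states, and let $\lambda_i$, $\rho$, $\delta_j$, $s_r$ be as defined in the context. Let $u\in\Sigma^*$ be a word of length $l$ and corank $r$ with $1\leqslant r\leqslant n/2-1$. Then there is a word of corank at least $r+1$ and length not exceeding $$l+\min\left\{\frac{(r+1)(r+2)}{2},\;2(1s_1+2s_2+3s_3+\ldots+rs_r)+2r\right\}.$$
   Context: A DFA $\mathcal{A}=(Q,\Sigma,\delta)$ has finite state set $Q$, finite alphabet $\Sigma$, total transition function $\delta:Q\times\Sigma\to Q$, extended to an action of $\Sigma^*$ on $Q$ written $q\cdot w$. The rank of a word $w$ is $|Q\cdot w|$ and its corank is $n-|Q\cdot w|$. $\mathcal{A}$ is synchronizing if some word has rank $1$. For $i\in\{0,\ldots,n-1\}$, $\lambda_i$ denotes the smallest length of a word of corank at least $i$ (so $0=\lambda_0\leqslant\cdots\leqslant\lambda_{n-1}$), and one sets $\lambda_n=+\infty$. $\rho$ is the smallest index $\rho\in\{0,\ldots,n-1\}$ with $\lambda_{\rho+1}-\lambda_\rho>n$. For $j\in\{0,\ldots,\rho\}$, $\delta_j=\lambda_{j+1}-\lambda_j$. For each positive integer $r\leqslant n/2$, $s_r$ is the number of indices $j\in\{0,\ldots,\rho\}$ with $\delta_j\in\{2r-1,2r\}$. *)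

(* Defs.v *)
From Stdlib Require Import ClassicalEpsilon.
From mathcomp Require Import all_boot.
Set Implicit Arguments. Unset Strict Implicit. Unset Printing Implicit Defensive.

Section DFA.
Variables (Q S : finType) (d : Q -> S -> Q).

Definition act (q : Q) (w : seq S) : Q := foldl d q w.

Definition image_set (w : seq S) : {set Q} := [set act q w | q : Q].

Definition rank (w : seq S) : nat := #|image_set w|.
Definition corank (w : seq S) : nat := #|Q| - rank w.

Definition synchronizing : Prop := exists w : seq S, rank w = 1.

Definition has_word (i L : nat) : bool :=
  [exists t : L.-tuple S, i <= corank t].

(* lambda_i (i in {0..n-1}) as Some (least length of a word of corank >= i),
   None standing for +infinity (used for lambda_n = +oo, and for lambda_i
   when no such word exists, which does not happen for synchronizing A). *)
Definition lam (i : nat) : option nat :=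
  match excluded_middle_informative (exists L, has_word i L) with
  | left h => if i < #|Q| then Some (ex_minn h) else None
  | right _ => None
  end.

Definition big_jump (j : nat) : bool :=
  match lam j.+1, lam j with
  | Some a, Some b => #|Q| < a - b
  | None, _ => true
  | Some _, None => false
  end.

Definition rho : nat := find big_jump (iota 0 #|Q|).

Definition delta_in (r j : nat) : bool :=
  match lam j.+1, lam j with
  | Some a, Some b => (a - b == r.*2.-1) || (a - b == r.*2)
  | _, _ => false
  end.

Definition s_ (r : nat) : nat := count (delta_in r) (iota 0 rho.+1).

End DFA.

(* Main.v *)
(* The first bound is the Pin-Frankl compression of the image Q.u, appended
   after u. For the second one, let m be the first index with delta_m > 2r; then
   lambda_m <= 2(s_1 + 2s_2 + ... + rs_r), and a word w of length lambda_m and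
   corank m stays of corank m when followed by any v with |v| <= 2r. At most 2r
   states lie in the set D of the non-singleton fibres of u, so a linear algebra
   argument gives v with |v| <= 2r for which Q.wv misses a state outside D;
   hence Q.wvu misses a state of Q.u. Both bounds on shortest words come from a
   triangular matrix indexed by the cut points of the word, factored through a
   space of small dimension. *)
Require Import Defs.
From mathcomp Require Import all_boot all_order all_algebra ring zify.
Set Implicit Arguments. Unset Strict Implicit. Unset Printing Implicit Defensive.
Import GRing.Theory Num.Theory.

(** * Rank bound for triangular matrices, shortest words, fibres of a map *)

Lemma triangular_leq_card (F : fieldType) (I : finType) (A : {set I}) (L : nat)
    (f : nat -> I -> F) (g : I -> nat -> F) :
  (forall i j, i < j -> j < L -> (\sum_(k in A) f i k * g k j = 0)%R) ->
  (forall i, i < L -> (\sum_(k in A) f i k * g k i != 0)%R) ->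
  L <= #|A|.
Proof.
move=> trig diag.
pose B := (\matrix_(i < L, k < #|A|) f i (enum_val k))%R.
pose C := (\matrix_(k < #|A|, j < L) g (enum_val k) j)%R.
have BC (i j : 'I_L) : (B *m C)%R i j = (\sum_(k in A) f i k * g k j)%R.
  by rewrite mxE [RHS]big_enum_val; apply: eq_bigr => k _; rewrite !mxE.
have BC_trig : is_trig_mx (B *m C)%R.
  by apply/is_trig_mxP => i j ltij; rewrite BC trig.
have BC_unit : (B *m C)%R \in unitmx.
  rewrite unitmxE det_trig // unitfE; apply/prodf_neq0 => i _.
  by rewrite BC diag.
(* The product has full rank [L], while its factor [B] has only [#|A|] columns. *)
rewrite -[X in X <= _](mxrank_unit BC_unit).
exact: leq_trans (mxrankM_maxl _ _) (rank_leq_col _).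
Qed.

Lemma shortest_word (S : finType) (P : pred (seq S)) :
  (exists v, P v) -> exists2 v, P v & forall v', P v' -> size v <= size v'.
Proof.
case=> v0 Pv0.
have exL : exists L, [exists t : L.-tuple S, P t].
  by exists (size v0); apply/existsP; exists (in_tuple v0).
case: (ex_minnP exL) => L /existsP[t Pt] minL.
exists t => // v' Pv'; rewrite size_tuple; apply: minL.
by apply/existsP; exists (in_tuple v').
Qed.

Lemma size_take_drop_ltn (S : Type) (v : seq S) i j :
  i < j -> j <= size v -> size (take i v ++ drop j v) < size v.
Proof.
by move=> ltij lejL; rewrite size_cat size_take size_drop; case: ifP; lia.
Qed.

(** A fibre of [k >= 2] points puts [k <= 2(k - 1)] points in the set; a singleton fibre puts
    none. *)
Lemma card_nontrivial_fibres (A B : finType) (h : A -> B) :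
  #|[set a | [exists b, (b != a) && (h b == h a)]]| <= (#|A| - #|h @: A|).*2.
Proof.
set D := [set a | _].
have cardI : #|h @: A| = \sum_(y in h @: A) 1 by rewrite sum1_card.
have cardP (P : pred A) : #|P| = \sum_(y in h @: A) \sum_(a in P | h a == y) 1.
  rewrite -sum1_card (partition_big h (mem (h @: A))) //.
  by move=> a _; apply: imset_f.
have -> : #|A| = \sum_(y in h @: A) #|[set a | h a == y]|.
  rewrite -cardsT cardP; apply: eq_bigr => y _; rewrite -sum1_card.
  by apply: eq_bigl => a; rewrite !inE.
rewrite cardI -sumnB; last first.
  by move=> _ /imsetP[a _ ->]; rewrite card_gt0; apply/set0Pn; exists a; rewrite inE.
rewrite -muln2 big_distrl cardP /=; apply: leq_sum => y _.
rewrite !sum1_card.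
have [a /andP[aD ay]|noD] := pickP (fun a => (a \in D) && (h a == y)); last first.
  by rewrite (eq_card0 noD).
apply: (@leq_trans #|[set a | h a == y]|).
  by apply: subset_leq_card; apply/subsetP => b; rewrite !inE => /andP[].
move: aD; rewrite inE => /existsP[b /andP[nba /eqP hba]].
have : 1 < #|[set a | h a == y]|.
  by apply/card_gt1P; exists b, a; rewrite !inE hba.
lia.
Qed.

(** * Monomials of bounded degree in two variables *)

Section TriangleMonomials.
Variable r : nat.

(** Exponents of the monomials of total degree at most [r]; they index the small space. *)
Definition triangle : {set 'I_r.+1 * 'I_r.+1} :=
  [set p : 'I_r.+1 * 'I_r.+1 | p.2 < r.+1 - p.1].

Lemma card_triangle : #|triangle| = (r.+1 * r.+2) %/ 2.
Proof.
rewrite -sum1_card (eq_bigl (fun p : 'I_r.+1 * 'I_r.+1 =>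
  true && (p.2 < r.+1 - p.1))); last by move=> p; rewrite inE.
rewrite -(pair_big_dep xpredT (fun k l : 'I_r.+1 => l < r.+1 - k) (fun _ _ => 1)) /=.
rewrite (eq_bigr (fun k : 'I_r.+1 => r.+1 - k)); last first.
  move=> k _; rewrite -(big_ord_widen _ (fun=> 1)) ?leq_subr //.
  by rewrite sum1_card card_ord.
rewrite (reindex_inj rev_ord_inj) /=.
rewrite (eq_bigr (fun k : 'I_r.+1 => k.+1)); last by move=> k _; have := ltn_ord k; lia.
have -> : r.+1 * r.+2 = (\sum_(k < r.+1) k.+1) * 2.
  by elim: r => [|m IH]; rewrite ?big_ord1 // big_ord_recr /= mulnDl -IH; lia.
by rewrite mulnK.
Qed.

Local Open Scope ring_scope.

Lemma size_coef_prod_linear (F : fieldType) (s : seq {poly F}) (k : nat) :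
  all (fun l : {poly F} => size l <= 2)%N s ->
  (size ((\prod_(l <- s) ('X + l%:P))`_k)%R <= (size s).+1 - k)%N.
Proof.
elim: s k => [|l s IH] k /=.
  by rewrite big_nil coef1; case: k => [|k] _ /=; rewrite ?size_poly1 ?size_poly0.
case/andP=> szl /IH{}IH; rewrite big_cons mulrDl coefD mulrC coefMX coefCM.
apply: leq_trans (size_polyD _ _) _; rewrite geq_max; apply/andP; split.
  by case: k => [|k]; rewrite /= ?size_poly0 //; apply: leq_trans (IH k) _; lia.
move: (IH k); move: (_`_k) => c szc.
(* For [c = 0] the size bound for products could give 1, too much for large [k]. *)
have [->|] := eqVneq c 0; first by rewrite mulr0 size_poly0.
rewrite -size_poly_gt0 => c0; apply: leq_trans (size_polyMleq _ _) _.
by move: (size l) (size c) szl szc c0 => a b; lia.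
Qed.

(** Separates variables: the coefficients depend on [s] alone, the monomials on [x] and [y] alone.
    This is the factorization fed to [triangular_leq_card]. *)
Lemma prod_linear_triangle (F : fieldType) (s : seq {poly F}) (x y : F) :
  all (fun l : {poly F} => size l <= 2)%N s -> size s = r ->
  \prod_(l <- s) (y + l.[x]) =
  \sum_(p in triangle)
     (\prod_(l <- s) ('X + l%:P))`_(p.1)`_(p.2) * (y ^+ p.1 * x ^+ p.2).
Proof.
move=> szs szr; set P : {poly {poly F}} := \prod_(l <- s) ('X + l%:P).
have szP k : (size (P`_k)%R <= r.+1 - k)%N by rewrite -szr; apply: size_coef_prod_linear.
have -> : \prod_(l <- s) (y + l.[x]) = P.[y%:P].[x].
  rewrite /P horner_prod horner_prod; apply: eq_bigr => l _.
  by rewrite !hornerE.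
have szP' : (size P <= r.+1)%N.
  apply/leq_sizeP => k ltrk; apply/eqP; rewrite -size_poly_leq0.
  by apply: leq_trans (szP k) _; lia.
rewrite (horner_coef_wide _ szP') horner_sum.
rewrite (eq_bigl (fun p : 'I_r.+1 * 'I_r.+1 =>
  true && (p.2 < r.+1 - p.1)%N)); last by move=> p; rewrite inE.
rewrite -(pair_big_dep xpredT (fun k l : 'I_r.+1 => l < r.+1 - k)%N
   (fun k l : 'I_r.+1 => P`_k`_l * (y ^+ k * x ^+ l))) /=.
apply: eq_bigr => k _; rewrite hornerM -polyC_exp hornerC (horner_coef_wide _ (szP k)).
rewrite (big_ord_widen r.+1 (fun l => P`_k`_l * x ^+ l)) ?leq_subr // mulr_suml.
by apply: eq_bigr => l _; ring.
Qed.

End TriangleMonomials.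

(** * Action of words and compression of a set of states *)

Section Automaton.
Variables (Q S : finType) (d : Q -> S -> Q).

Lemma act_cat q v w : act d q (v ++ w) = act d (act d q v) w.
Proof. exact: foldl_cat. Qed.

Lemma image_set_cat v w : image_set d (v ++ w) = (act d)^~ w @: image_set d v.
Proof.
rewrite /image_set -imset_comp; apply: eq_imset => q; exact: act_cat.
Qed.

Lemma card_image_set w : #|image_set d w| = #|Q| - corank d w.
Proof. by rewrite subKn // max_card. Qed.

Lemma corank_lt w : 0 < #|Q| -> corank d w < #|Q|.
Proof.
move=> Q0; rewrite /corank ltn_subrL Q0 andbT card_gt0.
by case/card_gt0P: Q0 => q _; apply/set0Pn; exists (act d q w); apply: imset_f.
Qed.

Lemma synchronizing_const :
  synchronizing d -> exists v p, forall q, act d q v = p.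
Proof.
case=> v /eqP/cards1P[p Ep]; exists v, p => q.
by apply/set1P; rewrite -Ep imset_f.
Qed.

(* Along a shortest word merging two states a, b of T, the pair
   reached after j letters is not contained in the i-th image of T for i < j.
   With states labelled by distinct rationals, containment is detected by
   prod_(c not in the image) (c - a)(c - b), a polynomial of degree <= r in
   a + b and ab. *)
Lemma compress_set (T : {set Q}) (r : nat) :
  synchronizing d -> #|~: T| = r -> 1 < #|T| ->
  exists2 v, size v <= (r.+1 * r.+2) %/ 2 & #|(act d)^~ v @: T| < #|T|.
Proof.
move=> sync cardTC T_gt1.
have [|v bad_v vmin] :=
    @shortest_word S (fun v => #|(act d)^~ v @: T| < #|T|).
  have [v [p vp]] := synchronizing_const sync; exists v.
  apply: leq_ltn_trans T_gt1; rewrite -(cards1 p); apply: subset_leq_card.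
  by apply/subsetP => _ /imsetP[q _ ->]; rewrite vp set11.
exists v => //.
have good w : size w < size v -> {in T &, injective ((act d)^~ w)}.
  move=> ltw; apply/imset_injP; rewrite eqn_leq leq_imset_card leqNgt.
  by apply/negP => /vmin; rewrite leqNgt ltw.
have /dinjectivePn[a aT [b /andP[/= nba bT] vab]] :
    ~~ dinjectiveb ((act d)^~ v) T.
  by apply: contraTN bad_v => /dinjectiveP/card_in_imset->; rewrite ltnn.
pose img i := (act d)^~ (take i v) @: T.
pose t (q : Q) : rat := ((enum_rank q)%:R)%R.
have t_inj : injective t.
  by move=> p q /eqP; rewrite eqr_nat => /eqP/val_inj/enum_rank_inj.
pose ta j := t (act d a (take j v)); pose tb j := t (act d b (take j v)).
(* From [(t c - A)(t c - B) = AB + (t c ^ 2 - t c (A + B))], with [y = AB] and [x = A + B]. *)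
pose s i := [seq ((t c ^+ 2)%:P - t c *: 'X)%R | c <- enum (~: img i)].
rewrite -card_triangle.
pose f i (p : 'I_r.+1 * 'I_r.+1) :=
  ((\prod_(l <- s i) ('X + l%:P))`_(p.1)`_(p.2))%R.
pose g (p : 'I_r.+1 * 'I_r.+1) j :=
  ((ta j * tb j) ^+ p.1 * (ta j + tb j) ^+ p.2)%R.
have fg i j : i < size v ->
    (\sum_(p in triangle r) f i p * g p j =
     \prod_(c in ~: img i) ((t c - ta j) * (t c - tb j)))%R.
  move=> lti; rewrite -prod_linear_triangle.
  - rewrite big_map big_enum; apply: eq_bigr => c _.
    by rewrite hornerD hornerN hornerZ hornerX hornerC; ring.
  - apply/allP => _ /mapP[c _ ->]; apply: leq_trans (size_polyD _ _) _.
    rewrite size_polyN geq_max (leq_trans (size_polyC_leq1 _)) //.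
    by rewrite (leq_trans (size_scale_leq _ _)) // size_polyX.
  - rewrite size_map -cardE -cardTC.
    have := cardsC T; have := cardsC (img i).
    rewrite [X in X + _ = _]card_in_imset; first by rewrite /img; lia.
    by apply: good; rewrite size_takel // ltnW.
apply: (triangular_leq_card (f := f) (g := g)) => [i j ltij ltj | i lti].
  rewrite fg; last exact: ltn_trans ltj.
  apply/eqP/prodf_eq0.
  have [ai|ai] := boolP (act d a (take j v) \in img i); last first.
    by exists (act d a (take j v)); rewrite ?inE // subrr mul0r.
  have [bi|bi] := boolP (act d b (take j v) \in img i); last first.
    by exists (act d b (take j v)); rewrite ?inE // subrr mulr0.
  (* Cutting out the letters between [i] and [j] leaves a word merging [a'] and [b']. It is shorter
     than [v], so [a' = b']; but then [take j v] already merges [a] and [b]. *)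
  case/imsetP: ai => a' a'T ea; case/imsetP: bi => b' b'T eb.
  have eab : a' = b'.
    apply: (good (take i v ++ drop j v)) => //.
      by apply: size_take_drop_ltn => //; apply: ltnW.
    by rewrite !act_cat -ea -eb -!act_cat cat_take_drop.
  case/eqP: nba; apply: (good (take j v)) => //.
    by rewrite size_takel // ltnW.
  by rewrite ea eb eab.
rewrite fg //; apply/prodf_neq0 => c; rewrite inE => cT.
rewrite mulf_neq0 // subr_eq0; apply: contra cT => /eqP/t_inj->;
  exact: imset_f.
Qed.

(** * Multiplicities: the linear action of words on characteristic vectors *)

Definition mult (T : {set Q}) (v : seq S) (q : Q) : nat :=
  \sum_(p in T) (act d p v == q).

Lemma mult_cat T v w q :
  mult T (v ++ w) q = \sum_p mult T v p * (act d p w == q).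
Proof.
under [RHS]eq_bigr => p _ do rewrite big_distrl /=.
rewrite exchange_big; apply: eq_bigr => p _.
rewrite act_cat (bigD1 (act d p v)) //= eqxx mul1n big1 ?addn0 // => p'.
by rewrite eq_sym => /negPf->.
Qed.

Lemma sum_mult T v : \sum_q mult T v q = #|T|.
Proof.
rewrite exchange_big -sum1_card; apply: eq_bigr => p _.
by rewrite (bigD1 (act d p v)) //= eqxx big1 // => p'; rewrite eq_sym => /negPf->.
Qed.

(* Until the shortest such v is completed, the multiplicity vectors are 1 off D
   and have total #|T|: they live in an affine space of dimension #|D| - 1. *)
Lemma unbalance_outside (T D : {set Q}) :
  synchronizing d -> D != set0 -> 1 < #|~: D| ->
  exists v q, [/\ size v <= #|D|, q \notin D & mult T v q != 1].
Proof.
move=> sync /set0Pn[d0 d0D] D'_gt1.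
pose bad v := [exists q in ~: D, mult T v q != 1].
have [|v /exists_inP[q]] := @shortest_word S bad.
  (* A constant word gives multiplicity 0 to every state but its value [p], and some such state lies
     outside [D]. *)
  have [v [p vp]] := synchronizing_const sync; exists v.
  have [q] : exists q, q \in (~: D) :\ p.
    by apply/set0Pn; rewrite -card_gt0; have := cardsD1 p (~: D); case: (p \in _); lia.
  rewrite in_setD1 => /andP[qp qD]; apply/exists_inP; exists q => //.
  by rewrite /mult big1 // => p' _; rewrite vp eq_sym (negPf qp).
rewrite inE => qD vq vmin; exists v, q; split=> //.
have good w p : size w < size v -> p \notin D -> mult T w p = 1.
  move=> ltw pD; apply/eqP/negPn/negP => nb.
  have /vmin : bad w by apply/exists_inP; exists p; rewrite ?inE.
  by rewrite leqNgt ltw.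
pose chi j p : rat := (act d p (drop j v) == q)%:R%R.
pose x i p : rat := (mult T (take i v) p)%:R%R.
(* As x i sums to K over D, its coordinate at d0 is redundant and is replaced by
   the constant 1, which absorbs the affine part. *)
pose K : rat := (#|T|%:R - #|~: D|%:R)%R.
pose f i p := if p == d0 then 1%R else x i p.
pose g p j := if p == d0 then (\sum_(s in ~: D) chi j s - 1 + K * chi j d0)%R
              else (chi j p - chi j d0)%R.
(* For [i < j] the word on the right is shorter than [v], so the entry vanishes; for [i = j] it is
   [v] itself. *)
have fg i j : i < size v ->
    (\sum_(p in D) f i p * g p j = (mult T (take i v ++ drop j v) q)%:R - 1)%R.
  move=> ltiv.
  have xD' p : p \in ~: D -> x i p = 1%R.
    by rewrite inE => pD; rewrite /x good // size_takel // ltnW.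
  have splitD (F : Q -> rat) :
      (\sum_p F p = \sum_(p in ~: D) F p + (F d0 + \sum_(p in D :\ d0) F p))%R.
    rewrite -big_setD1 // [LHS](bigID (mem D)) /= addrC; congr (_ + _)%R.
    by apply: eq_bigl => p; rewrite inE.
  have sumx : (K = x i d0 + \sum_(p in D :\ d0) x i p)%R.
    apply/eqP; rewrite /K subr_eq addrC -(sum_mult T (take i v)) natr_sum.
    rewrite (splitD (x i)) (eq_bigr _ xD') sumr_const; exact: eqxx.
  have fgD : (\sum_(p in D :\ d0) f i p * g p j =
      \sum_(p in D :\ d0) x i p * chi j p
        - (\sum_(p in D :\ d0) x i p) * chi j d0)%R.
    rewrite mulr_suml -sumrB; apply: eq_bigr => p.
    by rewrite in_setD1 => /andP[/negPf pd0 _]; rewrite /f /g pd0 mulrBr.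
  rewrite mult_cat natr_sum.
  under eq_bigr => p _ do rewrite natrM -/(x i p) -/(chi j p).
  rewrite (splitD (fun p => x i p * chi j p)%R) (big_setD1 d0) //=.
  rewrite [f i d0]/f [g d0 j]/g eqxx sumx.
  under [in RHS]eq_bigr => p pD' do rewrite xD' // mul1r.
  by rewrite fgD; ring.
apply: (triangular_leq_card (f := f) (g := g)) => [i j ltij ltj | i lti].
  rewrite fg ?good ?subrr //; last exact: ltn_trans ltj.
  by apply: size_take_drop_ltn => //; apply: ltnW.
by rewrite fg // cat_take_drop subr_eq0 pnatr_eq1.
Qed.

(** * The thresholds [lam] and their jumps *)

Lemma lamP i L : lam d i = Some L ->
  (exists2 w, size w = L & i <= corank d w) /\
  (forall w, i <= corank d w -> L <= size w).
Proof.
rewrite /lam; case: ClassicalEpsilon.excluded_middle_informative => // h.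
case: ifP => // _ [<-]; case: ex_minnP => m /existsP[t it] minm; split.
  by exists t; rewrite ?size_tuple.
by move=> w iw; apply: minm; apply/existsP; exists (in_tuple w).
Qed.

Lemma lam_None i w : lam d i = None -> 0 < #|Q| -> ~~ (i <= corank d w).
Proof.
rewrite /lam => Hi Q0; apply/negP => iw.
have hw : exists L, has_word d i L.
  by exists (size w); apply/existsP; exists (in_tuple w).
move: Hi; case: ClassicalEpsilon.excluded_middle_informative => // h.
case: ifP => // /negP[]; exact: leq_ltn_trans iw (corank_lt w Q0).
Qed.

Lemma lam0 : 0 < #|Q| -> lam d 0 = Some 0.
Proof.
move=> Q0; case E: (lam d 0) => [L|]; last by have := lam_None [::] E Q0.
by have [_ /(_ [::] isT)] := lamP E; rewrite leqn0 => /eqP->.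
Qed.

Lemma big_jump_rho : 0 < #|Q| -> big_jump d (rho d).
Proof.
move=> Q0; have hasj : has (big_jump d) (iota 0 #|Q|).
  (* Coranks stay below [#|Q|], so the last threshold is infinite and the search for [rho]
     succeeds. *)
  apply/hasP; exists #|Q|.-1; first by rewrite mem_iota; lia.
  rewrite /big_jump prednK //; case E: (lam d #|Q|) => [a|] //.
  by have [[w _]] := lamP E; rewrite leqNgt corank_lt.
have := nth_find 0 hasj; rewrite nth_iota //.
by rewrite -[X in _ < X](size_iota 0 #|Q|) -has_find.
Qed.

Definition small_jump (c j : nat) : bool :=
  match lam d j.+1, lam d j with
  | Some a, Some b => a - b <= c
  | _, _ => false
  end.

(** The jump at [rho] exceeds [#|Q| >= c], so the first jump above [c] occurs within the range
    counted by [s_]. *)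
Lemma first_large_jump (c : nat) : 0 < #|Q| -> c <= #|Q| ->
  exists m, [/\ m <= rho d, ~~ small_jump c m & forall j, j < m -> small_jump c j].
Proof.
move=> Q0 cQ; have exm : exists m, ~~ small_jump c m.
  exists (rho d); have := big_jump_rho Q0; rewrite /big_jump /small_jump.
  by case: (lam d _.+1) (lam d (rho d)) => [a|] [b|] //; lia.
case: (ex_minnP exm) => m large_m minm; exists m; split=> // [|j ltjm].
  apply: minm; have := big_jump_rho Q0; rewrite /big_jump /small_jump.
  by case: (lam d _.+1) (lam d (rho d)) => [a|] [b|] //; lia.
by apply/negPn/negP => /minm; rewrite leqNgt ltjm.
Qed.

(** The jumps telescope from [lam d 0 = Some 0]; one equal to [2k - 1] or [2k] costs at most
    [2k]. *)
Lemma lam_small_jumps (r m : nat) : 0 < #|Q| ->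
  (forall j, j < m -> small_jump r.*2 j) ->
  exists2 L, lam d m = Some L &
    L <= (\sum_(1 <= k < r.+1) k * count (delta_in d k) (iota 0 m)).*2.
Proof.
move=> Q0; elim: m => [|m IH] small; first by exists 0; rewrite ?lam0.
have [j ltjm|b Eb leb] := IH; first by apply: small; apply: ltnW.
have := small m (ltnSn m); rewrite /small_jump Eb.
case Ea: (lam d m.+1) => [a|] // leab; exists a => //.
rewrite -[m.+1]addn1 iotaD /= add0n.
under eq_bigr => k _ do rewrite count_cat [count _ [:: m]]/= addn0 mulnDr.
rewrite big_split doubleD /=.
have [leba|ltba] := leqP a b; first by apply: leq_trans leba (leq_trans leb (leq_addr _ _)).
suff : a - b <= (\sum_(1 <= k < r.+1) k * delta_in d k m).*2 by lia.
pose k0 := uphalf (a - b).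
rewrite (bigD1_seq k0) ?iota_uniq ?mem_index_iota //=; last by rewrite /k0; lia.
have -> : delta_in d k0 m; last by rewrite /k0; lia.
by rewrite /delta_in Ea Eb /k0; lia.
Qed.

Lemma incompressible_word (r : nat) : 0 < #|Q| -> r.*2 <= #|Q| ->
  exists2 w, size w <= (\sum_(1 <= k < r.+1) k * s_ d k).*2 &
    forall v, size v <= r.*2 -> {in image_set d w &, injective ((act d)^~ v)}.
Proof.
move=> Q0 rQ; have [m [lem large small]] := first_large_jump Q0 rQ.
have [L EL leL] := lam_small_jumps Q0 small.
have [[w szw wm] _] := lamP EL; exists w.
  rewrite szw; apply: leq_trans leL _; rewrite leq_double.
  apply: leq_sum => k _; rewrite leq_mul2l; apply/orP; right.
  by rewrite /s_ -(subnKC (leqW lem)) iotaD count_cat leq_addr.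
move=> v szv; apply/imset_injP; rewrite eqn_leq leq_imset_card /= -image_set_cat.
(* A larger corank would put threshold [m + 1] within [2r] of threshold [m], against the choice of
   [m]. *)
have cor : corank d (w ++ v) <= m.
  rewrite leqNgt; apply/negP => corm; move: large; rewrite /small_jump EL.
  case E: (lam d m.+1) => [a|]; last by have := lam_None (w ++ v) E Q0; rewrite corm.
  by have [_ /(_ _ corm)] := lamP E; rewrite size_cat szw; lia.
by rewrite !card_image_set leq_sub2l // (leq_trans cor).
Qed.

End Automaton.

Theorem theorem5 (Q S : finType) (d : Q -> S -> Q) (u : seq S) (r : nat) :
  synchronizing d ->
  corank d u = r ->
  1 <= r -> (r.+1).*2 <= #|Q| ->
  exists w : seq S,
    r.+1 <= corank d w /\
    size w <= size u +
      minn (((r.+1) * (r.+2)) %/ 2)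
           ((\sum_(1 <= k < r.+1) k * s_ d k).*2 + r.*2).
Proof.
move=> sync cor_u r1 rQ.
have rank_u := card_image_set d u; rewrite cor_u in rank_u.
rewrite /minn; case: ifP => _.
  have [||v szv lt_v] := @compress_set Q S d (image_set d u) r sync.
  - by have := cardsC (image_set d u); lia.
  - lia.
  exists (u ++ v); rewrite size_cat leq_add2l; split=> //.
  by rewrite /corank /rank image_set_cat; lia.
have Q0 : 0 < #|Q| by lia.
have r2Q : r.*2 <= #|Q| by lia.
have [w szw inj_w] := incompressible_word d Q0 r2Q.
set D : {set Q} := [set a | [exists b, (b != a) && (act d b u == act d a u)]].
have cardD : #|D| <= r.*2.
  by rewrite -cor_u; apply: (card_nontrivial_fibres ((act d)^~ u)).
have [||v [q [szv qD vq]]] := @unbalance_outside Q S d (image_set d w) D sync.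
(* If [D] were empty, [u] would act injectively and have corank 0. *)
- apply: contraTneq r1 => D0; rewrite -cor_u -leqNgt.
  have : #|(act d)^~ u @: setT| = #|Q|.
    rewrite card_imset ?cardsT // => a b eab; apply/eqP/negPn/negP => nab.
    by have := in_set0 b; rewrite -D0 inE => /existsP[]; exists a; rewrite nab eab eqxx.
  rewrite /corank /rank => <-; rewrite leqn0 subn_eq0 subset_leq_card //.
  by apply/subsetP => _ /imsetP[p _ ->]; apply: imset_f.
(* Here [#|D| <= 2r] and [2(r + 1) <= #|Q|] leave two states outside [D]. *)
- by have := cardsC D; lia.
have szv' : size v <= r.*2 := leq_trans szv cardD.
(* As [v] is injective on the image of [w], the multiplicity of [q] is at most 1; being different
   from 1, it is 0. *)
have avoid p : p \in image_set d w -> act d p v != q.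
  move=> pT; apply: contraNneq vq => pq; rewrite /mult (bigD1 p) //= pq eqxx.
  rewrite big1 // => p' /andP[p'T]; apply: contraNeq; rewrite eqb0 negbK => /eqP p'q.
  by apply/eqP; apply: inj_w szv' _ _ _ _ _ => //; rewrite p'q.
exists (w ++ v ++ u); rewrite !size_cat; split; last by lia.
(* Since [q] is outside [D], it is the only state that [u] sends to [act d q u]. *)
have : image_set d (w ++ v ++ u) \subset image_set d u :\ act d q u.
  apply/subsetP => _ /imsetP[p _ ->]; rewrite !act_cat in_setD1 imset_f // andbT.
  apply: contraNneq qD => eq_u; rewrite inE; apply/existsP.
  by exists (act d (act d p w) v); rewrite eq_u eqxx andbT avoid // imset_f.
move/subset_leq_card; have := cardsD1 (act d q u) (image_set d u).
by rewrite imset_f // /corank /rank; lia.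
Qed.
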